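(* Let $\varphi : X \to Y$ be a morphism in $\mathscr{C}$ with kernel $\kappa : K\to X$. Then $\varphi$ is $\{1,3\}$-invertible if and only if $\varphi$ is regular and $\kappa\kappa^{*} : K\to K$ is invertible. In this case, for every $\psi : Y\to X$ with $\varphi\psi\varphi=\varphi$, $$\psi\,[1_X-\kappa^{*}(\kappa\kappa^{*})^{-1}\kappa]$$ is a $\{1,3\}$-inverse of $\varphi$.
   Context: $\mathscr{C}$ is an additive category with an involution $*$: a map on morphisms sending $\varphi : X\to Y$ to $\varphi^* : Y \to X$ such that $(\varphi^* )^*=\varphi$, $(\varphi\psi)^*=\psi^*\varphi^*$ and $(\varphi+\phi)^*=\varphi^*+\phi^*$. Composition is written left to right: for $\varphi : X\to Y$ and $\psi : Y\to Z$, $\varphi\psi : X \to Z$ means ''first $\varphi$, then $\psi$''. A kernel of $\varphi : X\to Y$ is a morphism $\kappa : K\to X$ with $\kappa\varphi=0$ such that every $\alpha : M\to X$ with $\alpha\varphi=0$ factors uniquely as $\alpha=\alpha'\kappa$. $\varphi$ is regular if there is $\chi : Y\to X$ with $\varphi\chi\varphi=\varphi$. A $\{1,3\}$-inverse of $\varphi$ is a morphism $\chi : Y\to X$ with $\varphi\chi\varphi=\varphi$ and $(\varphi\chi)^*=\varphi\chi$. A morphism is invertible if it has a two-sided inverse. *)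

(* Defs.v *)
(* an additive category with involution, built by hand
   (no category-theory library is installed). Composition is written
   left to right: [mcomp f g] means "first f, then g". *)
From HB Require Import structures.
From mathcomp Require Import all_boot all_order all_algebra.
Set Implicit Arguments. Unset Strict Implicit. Unset Printing Implicit Defensive.
Import GRing.Theory.
Local Open Scope ring_scope.

Record AddCatInv := {
  Ob : Type;
  Mor : Ob -> Ob -> zmodType;
  mcomp : forall X Y Z : Ob, Mor X Y -> Mor Y Z -> Mor X Z;
  midm : forall X : Ob, Mor X X;
  compA : forall (W X Y Z : Ob) (f : Mor W X) (g : Mor X Y) (h : Mor Y Z),
      mcomp f (mcomp g h) = mcomp (mcomp f g) h;
  comp1m : forall (X Y : Ob) (f : Mor X Y), mcomp (midm X) f = f;
  compm1 : forall (X Y : Ob) (f : Mor X Y), mcomp f (midm Y) = f;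
  compDl : forall (X Y Z : Ob) (f f' : Mor X Y) (g : Mor Y Z),
      mcomp (f + f') g = mcomp f g + mcomp f' g;
  compDr : forall (X Y Z : Ob) (f : Mor X Y) (g g' : Mor Y Z),
      mcomp f (g + g') = mcomp f g + mcomp f g';
  zero_ob : Ob;
  zero_obP : midm zero_ob = 0;
  biprod : Ob -> Ob -> Ob;
  bi_p1 : forall X Y, Mor (biprod X Y) X;
  bi_p2 : forall X Y, Mor (biprod X Y) Y;
  bi_i1 : forall X Y, Mor X (biprod X Y);
  bi_i2 : forall X Y, Mor Y (biprod X Y);
  bi_i1p1 : forall X Y, mcomp (bi_i1 X Y) (bi_p1 X Y) = midm X;
  bi_i2p2 : forall X Y, mcomp (bi_i2 X Y) (bi_p2 X Y) = midm Y;
  bi_i1p2 : forall X Y, mcomp (bi_i1 X Y) (bi_p2 X Y) = 0;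
  bi_i2p1 : forall X Y, mcomp (bi_i2 X Y) (bi_p1 X Y) = 0;
  bi_sum : forall X Y, mcomp (bi_p1 X Y) (bi_i1 X Y) + mcomp (bi_p2 X Y) (bi_i2 X Y)
                       = midm (biprod X Y);
  mstar : forall X Y : Ob, Mor X Y -> Mor Y X;
  starK : forall (X Y : Ob) (f : Mor X Y), mstar (mstar f) = f;
  star_comp : forall (X Y Z : Ob) (f : Mor X Y) (g : Mor Y Z),
      mstar (mcomp f g) = mcomp (mstar g) (mstar f);
  starD : forall (X Y : Ob) (f g : Mor X Y), mstar (f + g) = mstar f + mstar g
}.

Arguments Mor : clear implicits.
Arguments mcomp {_ X Y Z}.
Arguments midm {_}.
Arguments mstar {_ X Y}.

Section Defs.
Variable C : AddCatInv.

Definition is_kernel (X Y K : Ob C) (phi : Mor C X Y) (kappa : Mor C K X) : Prop :=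
  mcomp kappa phi = 0 /\
  forall (M : Ob C) (alpha : Mor C M X), mcomp alpha phi = 0 ->
    exists! alpha' : Mor C M K, mcomp alpha' kappa = alpha.

Definition regular (X Y : Ob C) (phi : Mor C X Y) : Prop :=
  exists chi : Mor C Y X, mcomp (mcomp phi chi) phi = phi.

Definition inv13 (X Y : Ob C) (phi : Mor C X Y) (chi : Mor C Y X) : Prop :=
  mcomp (mcomp phi chi) phi = phi /\ mstar (mcomp phi chi) = mcomp phi chi.

Definition is_inverse (X Y : Ob C) (f : Mor C X Y) (g : Mor C Y X) : Prop :=
  mcomp f g = midm X /\ mcomp g f = midm Y.

Definition invertible (X Y : Ob C) (f : Mor C X Y) : Prop :=
  exists g : Mor C Y X, is_inverse f g.

End Defs.

(* Main.v *)
Require Import Defs.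
From HB Require Import structures.
From mathcomp Require Import all_boot all_order all_algebra.
Import GRing.Theory.
Local Open Scope ring_scope.

(* Proof idea: since [phi psi phi = phi], the morphism [1 - phi psi] kills [phi]
   and so factors as [a kappa]; as [kappa] is monic, [kappa a = 1].
   If [psi] is a {1,3}-inverse, [a kappa] is self-adjoint and [a^* a] inverts
   [kappa kappa^*].  Conversely, if [u] inverts [kappa kappa^*], [1 - kappa^* u kappa] is the
   self-adjoint projection fixing [phi] on the right, and composing it after
   [phi psi = 1 - a kappa] absorbs the [a kappa] term since [kappa kappa^* u = 1]. *)

Section AdditiveCategoryFacts.
Set Implicit Arguments. Unset Strict Implicit.
Variable C : AddCatInv.

Lemma comp0l (X Y Z : Ob C) (g : Mor C Y Z) : mcomp (0 : Mor C X Y) g = 0.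
Proof. by apply: (addrI (mcomp (0 : Mor C X Y) g)); rewrite -compDl !addr0. Qed.

Lemma comp0r (X Y Z : Ob C) (f : Mor C X Y) : mcomp f (0 : Mor C Y Z) = 0.
Proof. by apply: (addrI (mcomp f 0)); rewrite -compDr !addr0. Qed.

Lemma compNl (X Y Z : Ob C) (f : Mor C X Y) (g : Mor C Y Z) :
  mcomp (- f) g = - mcomp f g.
Proof. by apply: (addrI (mcomp f g)); rewrite -compDl !subrr comp0l. Qed.

Lemma compNr (X Y Z : Ob C) (f : Mor C X Y) (g : Mor C Y Z) :
  mcomp f (- g) = - mcomp f g.
Proof. by apply: (addrI (mcomp f g)); rewrite -compDr !subrr comp0r. Qed.

Lemma compBl (X Y Z : Ob C) (f f' : Mor C X Y) (g : Mor C Y Z) :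
  mcomp (f - f') g = mcomp f g - mcomp f' g.
Proof. by rewrite compDl compNl. Qed.

Lemma compBr (X Y Z : Ob C) (f : Mor C X Y) (g g' : Mor C Y Z) :
  mcomp f (g - g') = mcomp f g - mcomp f g'.
Proof. by rewrite compDr compNr. Qed.

Lemma star0 (X Y : Ob C) : mstar (0 : Mor C X Y) = 0.
Proof. by apply: (addrI (mstar (0 : Mor C X Y))); rewrite -starD !addr0. Qed.

Lemma starN (X Y : Ob C) (f : Mor C X Y) : mstar (- f) = - mstar f.
Proof. by apply: (addrI (mstar f)); rewrite -starD !subrr star0. Qed.

Lemma starB (X Y : Ob C) (f g : Mor C X Y) : mstar (f - g) = mstar f - mstar g.
Proof. by rewrite starD starN. Qed.

Lemma star1 (X : Ob C) : mstar (midm X) = midm X.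
Proof.
have -> : mstar (midm X) = mcomp (mstar (midm X)) (mstar (mstar (midm X))).
  by rewrite starK compm1.
by rewrite -star_comp compm1 starK.
Qed.

Lemma star_comp_star (X Y : Ob C) (f : Mor C X Y) :
  mstar (mcomp f (mstar f)) = mcomp f (mstar f).
Proof. by rewrite star_comp starK. Qed.

Lemma is_inverse_star (X Y : Ob C) (f : Mor C X Y) (g : Mor C Y X) :
  is_inverse f g -> is_inverse (mstar f) (mstar g).
Proof. by case=> fg gf; split; rewrite -star_comp ?fg ?gf star1. Qed.

Lemma is_inverse_uniq (X Y : Ob C) (f : Mor C X Y) (g g' : Mor C Y X) :
  is_inverse f g -> is_inverse f g' -> g = g'.
Proof.
by case=> _ gf [fg' _]; rewrite -[g]compm1 -fg' Defs.compA gf comp1m.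
Qed.

Lemma inverse_star_selfadjoint (X : Ob C) (f u : Mor C X X) :
  mstar f = f -> is_inverse f u -> mstar u = u.
Proof.
by move=> sf fu; have := is_inverse_star fu; rewrite sf => fsu; exact: is_inverse_uniq fsu fu.
Qed.

Lemma is_inverse_gram (K X : Ob C) (k : Mor C K X) (a : Mor C X K) :
  mcomp k a = midm K -> mstar (mcomp a k) = mcomp a k ->
  is_inverse (mcomp k (mstar k)) (mcomp (mstar a) a).
Proof.
move=> ka sak; have ak_star : mcomp (mstar a) (mstar k) = midm K.
  by rewrite -star_comp ka star1.
split.
- by rewrite Defs.compA -(Defs.compA k) -star_comp sak Defs.compA ka comp1m ka.
- by rewrite -Defs.compA (Defs.compA a) -sak star_comp !Defs.compA ak_star comp1m ak_star.
Qed.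

End AdditiveCategoryFacts.

Section KernelOfRegular.
Set Implicit Arguments. Unset Strict Implicit.
Variables (C : AddCatInv) (X Y K : Ob C) (phi : Mor C X Y) (kappa : Mor C K X).
Hypothesis hker : is_kernel phi kappa.

Lemma kernel_monic (M : Ob C) (f g : Mor C M K) :
  mcomp f kappa = mcomp g kappa -> f = g.
Proof.
have [kphi kfac] := hker; move=> fg.
have fkappa_phi : mcomp (mcomp f kappa) phi = 0 by rewrite -Defs.compA kphi comp0r.
have [fac [_ huniq]] := kfac M _ fkappa_phi.
by rewrite -(huniq f) // (huniq g).
Qed.

Lemma kernel_factor_inner_inverse (psi : Mor C Y X) :
  mcomp (mcomp phi psi) phi = phi ->
  exists2 a : Mor C X K, mcomp a kappa = midm X - mcomp phi psi
                       & mcomp kappa a = midm K.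
Proof.
have [kphi kfac] := hker; move=> phi_psi.
have [a [akappa _]] : exists! a : Mor C X K, mcomp a kappa = midm X - mcomp phi psi.
  by apply: kfac; rewrite compBl comp1m phi_psi subrr.
exists a => //; apply: kernel_monic.
by rewrite -Defs.compA akappa compBr compm1 Defs.compA kphi comp0l subr0 comp1m.
Qed.

Lemma inv13_gram_inverse (chi : Mor C Y X) :
  inv13 phi chi -> invertible (mcomp kappa (mstar kappa)).
Proof.
case=> phi_chi s_chi; have [a akappa kappa_a] := kernel_factor_inner_inverse phi_chi.
by exists (mcomp (mstar a) a); apply: is_inverse_gram => //; rewrite akappa starB star1 s_chi.
Qed.

Section KernelProjection.
Variable u : Mor C K K.
Hypothesis gram_u : is_inverse (mcomp kappa (mstar kappa)) u.

Let P : Mor C X X := midm X - mcomp (mcomp (mstar kappa) u) kappa.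

Lemma kernel_projection_selfadjoint : mstar P = P.
Proof.
have su := inverse_star_selfadjoint (star_comp_star kappa) gram_u.
by rewrite /P starB star1 !star_comp starK su Defs.compA.
Qed.

Lemma kernel_projection_fixes : mcomp P phi = phi.
Proof. by rewrite /P compBl comp1m -Defs.compA hker.1 comp0r subr0. Qed.

Lemma kernel_projection_absorbs (psi : Mor C Y X) :
  mcomp (mcomp phi psi) phi = phi -> mcomp (mcomp phi psi) P = P.
Proof.
move=> phi_psi; have [a akappa _] := kernel_factor_inner_inverse phi_psi.
have -> : mcomp phi psi = midm X - mcomp a kappa by rewrite akappa opprB addrC subrK.
rewrite compBl comp1m /P compBr compm1 !Defs.compA -(Defs.compA a kappa) -(Defs.compA a _ u).
by rewrite gram_u.1 compm1 subrr subr0.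
Qed.

Lemma inv13_kernel_projection (psi : Mor C Y X) :
  mcomp (mcomp phi psi) phi = phi -> inv13 phi (mcomp psi P).
Proof.
move=> phi_psi; rewrite /inv13 Defs.compA kernel_projection_absorbs //.
by rewrite kernel_projection_fixes kernel_projection_selfadjoint.
Qed.

End KernelProjection.
End KernelOfRegular.

Theorem lemma3p1 (C : AddCatInv) (X Y K : Ob C) (phi : Mor C X Y) (kappa : Mor C K X)
  (hker : is_kernel phi kappa) :
  ((exists chi : Mor C Y X, inv13 phi chi) <->
     (regular phi /\ invertible (mcomp kappa (mstar kappa)))) /\
  (forall (u : Mor C K K), is_inverse (mcomp kappa (mstar kappa)) u ->
   forall psi : Mor C Y X, mcomp (mcomp phi psi) phi = phi ->
     inv13 phi (mcomp psi (midm X - mcomp (mcomp (mstar kappa) u) kappa))).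
Proof.
split; last exact: inv13_kernel_projection.
split.
- case=> chi chi13; split; first by exists chi; case: chi13.
  exact: inv13_gram_inverse chi13.
- case=> [[psi phi_psi] [u gram_u]].
  by exists (mcomp psi (midm X - mcomp (mcomp (mstar kappa) u) kappa));
    apply: inv13_kernel_projection.
Qed.
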